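(* Let $C_0:c_0\to c_0$ be the Cesàro operator $C_0(x)=\left(\frac1n\sum_{k=1}^n x_k\right)_{n=1}^\infty$, $x=(x_n)_{n=1}^\infty\in c_0$, which is a positive operator belonging to $\mathcal{L}(c_0)$. Then its order spectrum coincides with its spectrum, that is, $\sigma_{\rm o}(C_0)=\sigma(C_0)$.
   Context: $\mathbb{N}=\{1,2,\ldots\}$. $c_0$ is the complex Banach lattice of null sequences in $\mathbb{C}^{\mathbb{N}}$ with the supremum norm and the coordinatewise order. For a complex Banach lattice $E$, $\mathcal{L}(E)$ is the unital Banach algebra of all continuous linear operators $E\to E$ (unit: the identity $I$). The spectrum of $T\in\mathcal{L}(E)$ is $\sigma(T)=\{\lambda\in\mathbb{C}:\lambda I-T \text{ is not invertible in }\mathcal{L}(E)\}$. An operator $T\in\mathcal{L}(E)$ is regular if it is a finite (complex) linear combination of positive operators; $\mathcal{L}^r(E)$ denotes the set of all regular operators, which is a unital algebra (a Banach algebra for the norm $\|T\|_r=\inf\{\|S\|_{\rm op}:S\in\mathcal{L}(E),\,S\ge0,\,|T(z)|\le S(|z|)\ \forall z\in E\}$). The order spectrum of $T\in\mathcal{L}^r(E)$ is $\sigma_{\rm o}(T)=\{\lambda\in\mathbb{C}:\lambda I-T\text{ is not invertible in }\mathcal{L}^r(E)\}$. *)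

(* Defs.v *)
From HB Require Import structures.
From mathcomp Require Import all_boot all_order all_algebra.
From mathcomp Require Import all_classical all_reals all_analysis.
From mathcomp Require Import complex.
Set Implicit Arguments.
Unset Strict Implicit.
Unset Printing Implicit Defensive.
Import Order.TTheory GRing.Theory Num.Theory numFieldNormedType.Exports.
Local Open Scope classical_set_scope.
Local Open Scope ring_scope.
Local Open Scope complex_scope.

(* Sequences are indexed from 0: the entry x n stands for x_{n+1}. *)
Section null_sequences.
Context {K : numFieldType}.

Definition null_seq : {pred nat -> K} :=
  [pred x : nat -> K | `[< x n @[n --> \oo] --> (0 : K) >]].

Lemma null_seqP (x : nat -> K) :
  reflect (x n @[n --> \oo] --> (0 : K)) (x \in null_seq).
Proof. by rewrite inE; exact: asboolP. Qed.

Lemma null_seq_normP (x : nat -> K) : (x \in null_seq) <->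
  (forall e : K, 0 < e -> \forall n \near \oo, `|x n| < e).
Proof.
split=> [/null_seqP/cvgr0Pnorm_lt //|h].
by apply/null_seqP/cvgr0Pnorm_lt.
Qed.

Lemma null_seq_submod_closed : submod_closed null_seq.
Proof.
split=> [|a x y /null_seqP x0 /null_seqP y0]; apply/null_seqP.
  exact: cvg_cst.
rewrite -[X in _ --> X]addr0 -[X in _ --> X + _](mulr0 a).
exact: (cvgD (cvgM (cvg_cst a) x0) y0).
Qed.

HB.instance Definition _ :=
  GRing.isSubmodClosed.Build K (nat -> K) null_seq null_seq_submod_closed.

End null_sequences.
Arguments null_seq : clear implicits.

Record c0 (K : numFieldType) :=
  C0Seq { c0_val :> nat -> K; _ : c0_val \in null_seq K }.

HB.instance Definition _ (K : numFieldType) := [isSub for @c0_val K].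
HB.instance Definition _ (K : numFieldType) := [Choice of c0 K by <:].
HB.instance Definition _ (K : numFieldType) :=
  [SubChoice_isSubLmodule of c0 K by <:].

Section order.
Context {K : numFieldType}.
Implicit Types x y z : c0 K.

Definition c0_le x y : bool := `[< forall n, x n <= y n >].

Lemma c0_le_refl : reflexive c0_le.
Proof. by move=> x; apply/asboolP. Qed.

Lemma c0_le_anti : antisymmetric c0_le.
Proof.
move=> x y /andP[/asboolP xy /asboolP yx]; apply/val_inj/funext => n.
by apply/le_anti; rewrite xy yx.
Qed.

Lemma c0_le_trans : transitive c0_le.
Proof.
move=> y x z /asboolP xy /asboolP yz; apply/asboolP => n.
exact: le_trans (xy n) (yz n).
Qed.

HB.instance Definition _ := Order.Le_isPOrder.Build ring_display (c0 K)
  c0_le_refl c0_le_anti c0_le_trans.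

Lemma c0_leP x y : x <= y <-> forall n, x n <= y n.
Proof. by split => [/asboolP|xy]; last apply/asboolP. Qed.

End order.

Section norm.
Context {R : realType}.
Implicit Types x y : c0 R[i].

Definition c0_sup x : R := sup (range (fun n => Normc.normc (x n))).

(* Norms on modules over R[i] take values in R[i]. *)
Definition c0_norm x : R[i] := (c0_sup x)%:C.

Lemma normr_normc (z : R[i]) : `|z| = (Normc.normc z)%:C.
Proof. by []. Qed.

Lemma normc_ge0 (z : R[i]) : 0 <= Normc.normc z.
Proof. by case: z => a b; exact: sqrtr_ge0. Qed.

Lemma null_seq_normcP (x : nat -> R[i]) : (x \in null_seq R[i]) <->
  Normc.normc (x n) @[n --> \oo] --> (0 : R).
Proof.
split.
- move=> /null_seq_normP h; apply/cvgr0Pnorm_lt => e e0.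
  have eC : 0 < e%:C by rewrite ltcR.
  have := h _ eC; apply: filterS => n.
  rewrite normr_normc ltcR => hn.
  by rewrite ger0_norm ?normc_ge0.
- move=> /cvgr0Pnorm_lt h; apply/null_seq_normP => e e0.
  have [eI eR] : complex.Im e = 0 /\ 0 < complex.Re e.
    by move: e0; case: (e) => a b; rewrite ltcE/= => /andP[/eqP-> ->].
  have := h _ eR; apply: filterS => n hn.
  have -> : e = (complex.Re e)%:C by case: (e) eI => a b /= ->.
  rewrite normr_normc ltcR; apply: le_lt_trans hn; exact: ler_norm.
Qed.

Lemma c0_bounded x : has_ubound (range (fun n => Normc.normc (x n))).
Proof.
have /null_seq_normcP/cvgr0Pnorm_lt/(_ _ ltr01)[N _ hN] := valP x.
exists (1 + \sum_(k < N) Normc.normc (x k)) => _ [n _ <-].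
have nn k : 0 <= Normc.normc (x k) by exact: normc_ge0.
have [nN|Nn] := ltnP n N.
  rewrite (bigD1 (Ordinal nN))//= addrCA lerDl addr_ge0 ?ler01//.
  exact: sumr_ge0.
have := hN n Nn; rewrite ger0_norm ?normc_ge0// => /ltW h.
by rewrite (le_trans h)// lerDl sumr_ge0.
Qed.

Lemma le_c0_sup x n : Normc.normc (x n) <= c0_sup x.
Proof. by apply: ub_le_sup; [exact: c0_bounded|exists n]. Qed.

Lemma c0_sup_le x (a : R) : (forall n, Normc.normc (x n) <= a) -> c0_sup x <= a.
Proof.
move=> h; apply: ge_sup; first by exists (Normc.normc (x 0%N)), 0%N.
by move=> _ [n _ <-].
Qed.

Lemma c0_sup_ge0 x : 0 <= c0_sup x.
Proof. exact: le_trans (normc_ge0 _) (le_c0_sup x 0). Qed.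

Lemma c0_normD x y : c0_norm (x + y) <= c0_norm x + c0_norm y.
Proof.
rewrite -rmorphD/= lecR; apply: c0_sup_le => n.
rewrite -lecR rmorphD/= -normr_normc; apply: le_trans (ler_normD _ _) _.
by rewrite !normr_normc -!rmorphD/= lecR lerD// le_c0_sup.
Qed.

Lemma c0_normZ (a : R[i]) x : c0_norm (a *: x) = `|a| * c0_norm x.
Proof.
rewrite normr_normc -rmorphM/=; congr (_%:C); apply/le_anti/andP; split.
  apply: c0_sup_le => n.
  rewrite [(a *: x) n]/(a * x n) Normc.normcM ler_wpM2l ?le_c0_sup//.
  exact: normc_ge0.
have [->|a0] := eqVneq a 0; first by rewrite Normc.normc0 mul0r c0_sup_ge0.
have na0 : 0 < Normc.normc a by rewrite -ltcR -normr_normc normr_gt0.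
rewrite -ler_pdivlMl//; apply: c0_sup_le => n.
by rewrite ler_pdivlMl// -Normc.normcM (le_c0_sup (a *: x)).
Qed.

Lemma c0_norm0_eq0 x : c0_norm x = 0 -> x = 0.
Proof.
case=> x0; apply/val_inj/funext => n; apply/Normc.eq0_normc/le_anti.
by rewrite -{1}x0 le_c0_sup normc_ge0.
Qed.

HB.instance Definition _ := Lmodule_isNormed.Build R[i] (c0 R[i])
  c0_normD c0_normZ c0_norm0_eq0.

End norm.

Section operators.
Context {R : realType}.

(* Operators are functions E -> E, which form a module pointwise; the sets
   below are the carriers of the algebras, with composition as product. *)
Definition bounded_op (E : normedModType R[i]) : set (E -> E) :=
  [set T | linear T /\ continuous T].

Definition positive_op (T : c0 R[i] -> c0 R[i]) : Prop :=
  forall x, 0 <= x -> 0 <= T x.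

Definition regular_op : set (c0 R[i] -> c0 R[i]) :=
  [set T | exists (n : nat) (a : 'I_n -> R[i])
    (S : 'I_n -> c0 R[i] -> c0 R[i]),
    (forall i, bounded_op (S i) /\ positive_op (S i)) /\
    T = \sum_(i < n) a i *: S i].

Definition invertible_in (E : Type) (A : set (E -> E)) (T : E -> E) : Prop :=
  exists S, [/\ A S, S \o T = id & T \o S = id].

Definition spectrum_in (E : lmodType R[i]) (A : set (E -> E)) (T : E -> E) :
  set R[i] := [set lambda | ~ invertible_in A (lambda *: (@id E) - T)].

Definition spectrum (T : c0 R[i] -> c0 R[i]) : set R[i] :=
  spectrum_in (@bounded_op (c0 R[i])) T.

Definition order_spectrum (T : c0 R[i] -> c0 R[i]) : set R[i] :=
  spectrum_in regular_op T.

End operators.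

Section cesaro_operator.
Context {R : realType}.

Definition cesaro_seq (x : nat -> R[i]) : nat -> R[i] :=
  fun n => n.+1%:R^-1 * \sum_(k < n.+1) x k.

Lemma cesaro_seq_null (x : c0 R[i]) : cesaro_seq x \in null_seq R[i].
Proof.
have /null_seq_normcP x0 := valP x.
apply/null_seq_normcP.
apply: (squeeze_cvgr _ (cvg_cst 0) (cesaro x0)); near=> n.
rewrite normc_ge0/= -lecR -normr_normc normrM normfV normr_nat rmorphM/=.
rewrite fmorphV/= rmorph_nat ler_wpM2l ?invr_ge0//.
rewrite (le_trans (ler_norm_sum _ _ _))//.
by rewrite /series/= big_mkord rmorph_sum.
Unshelve. all: by end_near. Qed.

Definition cesaro_op (x : c0 R[i]) : c0 R[i] := C0Seq (cesaro_seq_null x).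

End cesaro_operator.
Arguments cesaro_op : clear implicits.

(* Main.v *)
(** Every bounded operator on c0 is regular, so the two spectra are taken in the
same algebra. Indeed the matrix s of a bounded operator T has null columns, as
T maps basis vectors into c0, and uniformly summable rows, as one sees by
testing T on finitely supported vectors with unimodular or zero entries. Both properties pass to any
matrix dominated by a multiple of |s|, and conversely they ensure that a
nonnegative matrix defines a positive operator on c0. *)

From HB Require Import structures.
Require Import Defs.
From mathcomp Require Import all_boot all_order all_algebra.
From mathcomp Require Import all_classical all_reals all_analysis.
From mathcomp Require Import complex ring.
Set Implicit Arguments.
Unset Strict Implicit.
Unset Printing Implicit Defensive.
Import Order.TTheory GRing.Theory Num.Theory numFieldNormedType.Exports.
Local Open Scope classical_set_scope.
Local Open Scope ring_scope.
Local Open Scope complex_scope.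

(** * Convergence of complex sequences and series *)

Section complex_sequences.
Context {R : realType}.
Local Notation C := (R[i] : numFieldType).

Lemma cvg_real_complex (a : nat -> R) (l : R) :
  a n @[n --> \oo] --> l -> ((a n)%:C : C) @[n --> \oo] --> (l%:C : C).
Proof.
move=> al.
have /null_seqP al0 : (fun n => (a n)%:C - l%:C : C) \in null_seq C.
  apply/null_seq_normcP.
  rewrite (_ : (fun n => _) = fun n => `|a n - l|); last first.
    by apply/funext => n; rewrite -rmorphB /= expr0n/= addr0 sqrtr_sqr.
  rewrite -(@normr0 _ R); apply: cvg_norm; exact/subr_cvg0.
exact: (proj1 (@subr_cvg0 _ C _ _ _ (fun n => (a n)%:C : C) (l%:C : C)) al0).
Qed.

Lemma is_cvg_complex (u : nat -> C) :
  cvgn (fun n => complex.Re (u n)) -> cvgn (fun n => complex.Im (u n)) ->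
  cvgn u.
Proof.
move=> /cvg_real_complex cRe /cvg_real_complex cIm.
rewrite (_ : u = fun n => (complex.Re (u n))%:C + 'i%C * (complex.Im (u n))%:C).
  by apply/cvg_ex; eexists; exact: (@cvgD C C _ _ _ _ _ _ _ cRe
    (@cvgM C _ _ _ _ _ _ _ (cvg_cst ('i%C : C)) cIm)).
by apply/funext => n; rewrite -complexE.
Qed.

Lemma normc_ge_Im (z : R[i]) : `|complex.Im z|%:C <= `|z|.
Proof.
rewrite -normrN -ReiNIm (le_trans (normc_ge_Re _))//.
by rewrite normrM complexiE normCi mulr1.
Qed.

(** Real and imaginary parts are dominated by [|u k|], so both real series converge absolutely, and
    the complex series converges with them. *)
Lemma is_cvg_abs_bounded_series (u : nat -> C) (M : C) :
  (forall N, \sum_(k < N) `|u k| <= M) -> cvgn (fun N => \sum_(k < N) u k).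
Proof.
move=> uM; have M0 : 0 <= M by have := uM 0; rewrite big_ord0.
have abs_cvg (v : nat -> R) : (forall k, `|v k|%:C <= `|u k|) ->
    cvgn (fun N => \sum_(k < N) v k).
  move=> vu; rewrite (_ : (fun N => _) = series v); last first.
    by apply/funext => N; rewrite /series/= big_mkord.
  apply: normed_cvg; apply: nondecreasing_is_cvgn.
    by apply: nondecreasing_series => k _ _; exact: normr_ge0.
  exists (complex.Re M) => _ [N _ <-]; rewrite -lecR RRe_real ?ger0_real//.
  apply: le_trans (uM N).
  rewrite /normed_series_of/series/= big_mkord rmorph_sum.
  by apply: ler_sum => k _; exact: vu.
apply: is_cvg_complex.
- rewrite (_ : (fun N => complex.Re (\sum_(k < N) u k)) =
      fun N => \sum_(k < N) complex.Re (u k)).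
    exact: (abs_cvg (fun k => complex.Re (u k)) (fun k => normc_ge_Re (u k))).
  by apply/funext => N; apply: (big_morph (@complex.Re R)) => // -[? ?] [? ?].
- rewrite (_ : (fun N => complex.Im (\sum_(k < N) u k)) =
      fun N => \sum_(k < N) complex.Im (u k)).
    exact: (abs_cvg (fun k => complex.Im (u k)) (fun k => normc_ge_Im (u k))).
  by apply/funext => N; apply: (big_morph (@complex.Im R)) => // -[? ?] [? ?].
Qed.

Lemma cvg_le_norm (u : nat -> C) (l M : C) :
  u n @[n --> \oo] --> l -> (\forall n \near \oo, `|u n| <= M) -> `|l| <= M.
Proof.
move=> ul [N _ uM].
(* [M] is complex, and comparison by negation needs a real number; [M] is real because it dominates
   a modulus. *)
have MR : M \is Num.real by apply: ger0_real; apply: le_trans (uM N (leqnn N)).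
rewrite real_leNgt ?normr_real//; apply/negP => lM.
have [K _ hK] := @cvgr_norm_gt _ _ _ _ _ _ _ ul _ lM.
have := uM _ (leq_maxl N K); rewrite real_leNgt ?normr_real//.
by rewrite (hK _ (leq_maxr N K)).
Qed.

(** A nonnegative sequence is its own sequence of moduli, so [l = |l|] by uniqueness of limits. *)
Lemma cvg_ge0 (u : nat -> C) (l : C) :
  u n @[n --> \oo] --> l -> (forall n, 0 <= u n) -> 0 <= l.
Proof.
move=> ul u0; rewrite (_ : l = `|l|) ?normr_ge0//.
apply: (cvg_unique (@norm_hausdorff _ C) ul).
rewrite (_ : u = fun n => `|u n|); first exact: cvg_norm.
by apply/funext => n; rewrite ger0_norm.
Qed.

End complex_sequences.

(** * Norm and bounded operators on c0 *)

Section null_sequence_space.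
Context {R : realType}.
Local Notation C := (R[i] : numFieldType).
Implicit Types x y : c0 C.

Lemma le_c0_norm x n : `|x n| <= `|x|.
Proof. by rewrite normr_normc lecR le_c0_sup. Qed.

Lemma c0_norm_le x (a : C) : (forall n, `|x n| <= a) -> `|x| <= a.
Proof.
move=> xa; have aE : a = (complex.Re a)%:C.
  by rewrite RRe_real// ger0_real// (le_trans _ (xa 0%N)).
rewrite aE lecR; apply: c0_sup_le => n.
by rewrite -lecR -normr_normc -aE.
Qed.

Lemma c0_scaleE (a : C) x n : (a *: x) n = a * x n.
Proof. by []. Qed.

Lemma c0_addE x y n : (x + y) n = x n + y n.
Proof. by []. Qed.

Lemma c0_oppE x n : (- x) n = - x n.
Proof. by []. Qed.

Lemma bounded_opP (T : c0 C -> c0 C) : linear T ->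
  bounded_op T <-> exists2 M : C, 0 <= M & forall x, `|T x| <= M * `|x|.
Proof.
move=> linT; pose TL : {linear c0 C -> c0 C} :=
  HB.pack T (GRing.isLinear.Build _ _ _ _ _ linT).
split=> [[_ contT]|[M M0 TM]].
  have /linear_bounded_continuous/linear_boundedP : continuous TL by [].
  by move=> /pinfty_ex_gt0[M /ltW M0 TM]; exists M.
split=> //; apply/(linear_bounded_continuous TL)/bounded_funP => r.
exists (M * r) => x xr; apply: le_trans (TM x) _.
exact: ler_wpM2l.
Qed.

Definition c0_trunc_seq N (f : nat -> C) : nat -> C :=
  fun n => if (n < N)%N then f n else 0.

Lemma c0_trunc_null N f : c0_trunc_seq N f \in null_seq C.
Proof.
apply/null_seq_normP => e e0; exists N => // n /= Nn.
by rewrite /c0_trunc_seq ltnNge Nn normr0.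
Qed.

Definition c0_trunc N f : c0 C := C0Seq (c0_trunc_null N f).

(** The unit vector at [k]; [T (c0_delta k) n] is the matrix entry of [T] in row [n] and column
    [k]. *)
Definition c0_delta k : c0 C := c0_trunc k.+1 (fun n => (n == k)%:R).

Lemma c0_deltaE k n : c0_delta k n = (n == k)%:R.
Proof.
by rewrite /= /c0_trunc_seq ltnS; case: ltngtP.
Qed.

Lemma linear_c0_trunc (T : c0 C -> c0 C) N f n : linear T ->
  T (c0_trunc N f) n = \sum_(k < N) T (c0_delta k) n * f k.
Proof.
move=> linT; elim: N => [|N IHN].
  rewrite big_ord0 (_ : c0_trunc 0 f = 0); last exact: val_inj.
  (* Linearity with scalar [-1] gives [T 0 = - T 0 + T 0 = 0]. *)
  have := linT (-1) 0 0; rewrite scaler0 addr0 scaleN1r addNr => {1}->.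
  by [].
rewrite big_ord_recr /= -IHN mulrC -c0_scaleE -c0_addE addrC -linT.
congr (T _ n); apply/val_inj/funext => k.
rewrite [RHS]c0_addE c0_scaleE c0_deltaE /= /c0_trunc_seq ltnS leq_eqVlt.
by case: eqVneq => [->|_]; rewrite ?ltnn/= ?mulr1 ?addr0 ?mulr0 ?add0r.
Qed.

Lemma c0_trunc_cvg x : c0_trunc N x @[N --> \oo] --> x.
Proof.
apply/cvgrPdist_le => e e0.
have /null_seq_normP/(_ _ e0)[N _ xN] := valP x.
exists N => // K /= NK; apply: c0_norm_le => n.
rewrite c0_addE c0_oppE /= /c0_trunc_seq; case: ltnP => Kn.
  by rewrite subrr normr0 ltW.
by rewrite subr0 ltW// xN//= (leq_trans NK).
Qed.

Lemma c0_eval_cvg (u : nat -> c0 C) x n :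
  u N @[N --> \oo] --> x -> (u N n : C) @[N --> \oo] --> (x n : C).
Proof.
move=> ux; apply/cvgrPdist_le => e e0.
move/(@cvgrPdist_le _ (c0 C)) : ux => /(_ e e0)[K _ uK].
by exists K => // N /uK; apply: le_trans; exact: (le_c0_norm (x - u N)).
Qed.

(** The partial sums are the values of [T] at the truncations of [x], which converge to [x] in norm.
    Hence the matrix determines [T]. *)
Lemma bounded_op_series (T : c0 C -> c0 C) x n : bounded_op T ->
  (\sum_(k < N) T (c0_delta k) n * x k : C) @[N --> \oo] --> (T x n : C).
Proof.
move=> [linT contT].
rewrite (_ : (fun N => _) = fun N => T (c0_trunc N x) n); last first.
  by apply/funext => N; rewrite linear_c0_trunc.
apply: (@c0_eval_cvg (fun N => T (c0_trunc N x))).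
by apply: continuous_cvg; [exact: contT|exact: c0_trunc_cvg].
Qed.

Lemma bounded_op_row (T : c0 C -> c0 C) : bounded_op T ->
  exists M : C, forall n N, \sum_(k < N) `|T (c0_delta k) n| <= M.
Proof.
move=> bT; have [linT _] := bT; have /(bounded_opP linT)[M M0 TM] := bT.
exists M => n N.
(* The phase that turns each entry of row [n] into its modulus. Division by zero yields 0, so
   [|f k|] is at most 1 in all cases. *)
pose f k : C := `|T (c0_delta k) n| / T (c0_delta k) n.
have sumE : \sum_(k < N) `|T (c0_delta k) n| = T (c0_trunc N f) n.
  rewrite linear_c0_trunc//; apply: eq_bigr => k _; rewrite /f.
  have [->|s0] := eqVneq (T (c0_delta k) n) 0; first by rewrite normr0 mul0r.
  by rewrite mulrC divfK.
rewrite -[X in X <= _]ger0_norm ?sumr_ge0// sumE.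
apply: le_trans (le_c0_norm _ _) _.
apply: le_trans (TM _) _.
rewrite ler_piMr//; apply: c0_norm_le => k.
rewrite /= /c0_trunc_seq; case: ifP => _; last by rewrite normr0 ler01.
rewrite /f normrM normfV normr_id.
have [->|s0] := eqVneq (T (c0_delta k) n) 0.
  by rewrite normr0 mul0r ler01.
by rewrite divff// normr_eq0.
Qed.

(** * Operators given by nonnegative matrices *)

(** Split each row at [K]: the head is small since finitely many null columns add up to a null
    sequence, the tail since [x] is small there and row sums are at most [M]. *)
Lemma positive_matrix_null (q : nat -> nat -> C) (M : C) x (y : nat -> C) :
  (forall n k, 0 <= q n k) -> (forall n N, \sum_(k < N) q n k <= M) ->
  (forall k, (fun n => q n k) \in null_seq C) ->
  (forall n, (\sum_(k < N) q n k * x k : C) @[N --> \oo] --> (y n : C)) ->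
  y \in null_seq C.
Proof.
move=> q0 qM qcol qy; apply/null_seq_normP => e e0.
have M0 : 0 <= M by have := qM 0%N 0%N; rewrite big_ord0.
(* Adding 1 keeps the divisors positive even if [M] or [|x|] vanishes. *)
have M1 : 0 < M + 1 by rewrite ltr_wpDl.
have x1 : 0 < `|x| + 1 by rewrite ltr_wpDl.
have e20 : 0 < e / 2 by rewrite divr_gt0.
have /null_seq_normP/(_ _ (divr_gt0 e20 M1))[K _ xK] := valP x.
have : (\sum_(k < K) (fun n => q n k)) \in null_seq C by exact: rpred_sum.
move=> /null_seq_normP/(_ _ (divr_gt0 e20 x1)); apply: filterS => n.
rewrite fct_sumE ger0_norm ?sumr_ge0// => qK.
set a := \sum_(k < K) q n k in qK.
(* The head contributes the first term and the tail the second. The bound holds for all partial sums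
   with [N] at least [K], hence for the limit. *)
apply: (@le_lt_trans _ _ (a * `|x| + M * (e / 2 / (M + 1)))).
  apply: (cvg_le_norm (qy n)); exists K => // N /= KN.
  apply: le_trans (ler_norm_sum _ _ _) _.
  rewrite -(big_mkord predT (fun k => `|q n k * x k|)).
  rewrite (big_cat_nat (leq0n K) KN)//= lerD//.
    rewrite big_mkord mulr_suml; apply: ler_sum => k _.
    by rewrite normrM ger0_norm// ler_wpM2l// le_c0_norm.
  apply: le_trans (_ : (\sum_(K <= k < N) q n k) * (e / 2 / (M + 1)) <= _).
    rewrite mulr_suml big_nat_cond [leRHS]big_nat_cond.
    apply: ler_sum => k /andP[/andP[Kk _] _].
    by rewrite normrM ger0_norm// ler_wpM2l// ltW// xK.
  apply: ler_wpM2r; first by rewrite ltW// divr_gt0.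
  apply: le_trans (qM n N).
  by rewrite -(big_mkord predT (q n)) (big_cat_nat (leq0n K) KN)//= lerDr
    sumr_ge0.
rewrite [ltRHS]splitr ltrD//.
  apply: (@le_lt_trans _ _ (e / 2 / (`|x| + 1) * `|x|)).
    by rewrite ler_wpM2r// ltW.
  by rewrite mulrAC ltr_pdivrMr// ltr_pM2l// ltrDl.
by rewrite mulrA ltr_pdivrMr// mulrC ltr_pM2l// ltrDl.
Qed.

(** [S x] is the rowwise limit of the partial sums; linearity, the bound [M * |x|] and positivity
    all pass to the limit. *)
Lemma positive_matrix_op (q : nat -> nat -> C) (M : C) :
  (forall n k, 0 <= q n k) -> (forall n N, \sum_(k < N) q n k <= M) ->
  (forall k, (fun n => q n k) \in null_seq C) ->
  exists S : c0 C -> c0 C, [/\ bounded_op S, positive_op S & forall x n,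
    (\sum_(k < N) q n k * x k : C) @[N --> \oo] --> (S x n : C)].
Proof.
move=> q0 qM qcol.
have M0 : 0 <= M by have := qM 0%N 0%N; rewrite big_ord0.
have sum_le x n N : \sum_(k < N) `|q n k * x k| <= M * `|x|.
  apply: le_trans (_ : (\sum_(k < N) q n k) * `|x| <= _).
    rewrite mulr_suml; apply: ler_sum => k _.
    by rewrite normrM ger0_norm// ler_wpM2l// le_c0_norm.
  by rewrite ler_wpM2r.
pose y x n : C := limn (fun N => \sum_(k < N) q n k * x k : C).
have ycvg x n : (\sum_(k < N) q n k * x k : C) @[N --> \oo] --> (y x n : C).
  exact: (@is_cvg_abs_bounded_series R (fun k => q n k * x k) _ (sum_le x n)).
pose S x : c0 C := C0Seq (positive_matrix_null q0 qM qcol (ycvg x)).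
have Scvg x n : (\sum_(k < N) q n k * x k : C) @[N --> \oo] --> (S x n : C).
  exact: ycvg.
exists S; split => //.
- have linS : linear S.
    move=> a u v; apply/val_inj/funext => n.
    apply: (cvg_unique (@norm_hausdorff _ C) (Scvg _ n)).
    rewrite (_ : (fun N => _) = fun N =>
        a * (\sum_(k < N) q n k * u k) + \sum_(k < N) q n k * v k).
      exact: (@cvgD C C _ _ _ _ _ _ _
        (@cvgM C _ _ _ _ _ _ _ (cvg_cst (a : C)) (Scvg u n)) (Scvg v n)).
    apply/funext => N; rewrite mulr_sumr -big_split; apply: eq_bigr => k _.
    by rewrite c0_addE c0_scaleE mulrDr mulrCA.
  apply/(bounded_opP linS); exists M => // x; apply: c0_norm_le => n.
  apply: (cvg_le_norm (Scvg x n)); exists 0%N => // N _.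
  exact: le_trans (ler_norm_sum _ _ _) (sum_le x n N).
- move=> x /c0_leP x0; apply/c0_leP => n; apply: (cvg_ge0 (Scvg x n)) => N.
  by apply: sumr_ge0 => k _; apply: mulr_ge0; [exact: q0|exact: x0].
Qed.

(** * Bounded operators are exactly the regular ones *)

(** The factor 2 leaves room for [|s| + Re s] and [|s| + Im s], where [s] is the matrix of [T]. *)
Lemma dominated_matrix_op (T : c0 C -> c0 C) (q : nat -> nat -> C) :
  bounded_op T ->
  (forall n k, 0 <= q n k <= 2 * `|T (c0_delta k) n|) ->
  exists S : c0 C -> c0 C, [/\ bounded_op S, positive_op S & forall x n,
    (\sum_(k < N) q n k * x k : C) @[N --> \oo] --> (S x n : C)].
Proof.
move=> bT qT; have [M TM] := bounded_op_row bT.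
apply: (@positive_matrix_op _ (2 * M)) => [n k|n N|k].
- by case/andP: (qT n k).
- apply: le_trans (_ : 2 * (\sum_(k < N) `|T (c0_delta k) n|) <= _).
    by rewrite mulr_sumr; apply: ler_sum => k _; case/andP: (qT n k).
  by rewrite ler_wpM2l.
- apply/null_seq_normP => e e0.
  have /null_seq_normP/(_ _ (divr_gt0 e0 (ltr0n _ 2)))[K _ TK] :=
    valP (T (c0_delta k)).
  exists K => // n /TK TKn; case/andP: (qT n k) => q0 q2.
  by rewrite ger0_norm// (le_lt_trans q2)// mulrC -ltr_pdivlMr.
Qed.

(* T = S1 + i S2 - (1 + i) S0, where S0, S1, S2 have the nonnegative matrices
   |s|, |s| + Re s, |s| + Im s, all dominated by 2 |s|. *)
Lemma bounded_op_regular (T : c0 C -> c0 C) : bounded_op T -> regular_op T.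
Proof.
move=> bT; pose s n k : C := T (c0_delta k) n.
have pm (a : R) (b : C) : `|a|%:C <= b -> 0 <= b + a%:C <= 2 * b.
  move=> ab; have le_ab (c : R) : c <= `|a| -> c%:C <= b.
    by rewrite -lecR => /le_trans; exact.
  rewrite mulr2n mulrDl !mul1r lerD2l le_ab ?ler_norm// andbT addrC.
  by rewrite -lerBlDl sub0r -rmorphN le_ab// -normrN ler_norm.
have [S0 [bS0 pS0 cS0]] := @dominated_matrix_op T (fun n k => `|s n k|) bT
  (fun n k => introT andP
    (conj (normr_ge0 _) (ler_peMl (normr_ge0 _) (ler1n _ 2)))).
have [S1 [bS1 pS1 cS1]] := @dominated_matrix_op T
  (fun n k => `|s n k| + (complex.Re (s n k))%:C) bT
  (fun n k => pm _ _ (normc_ge_Re _)).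
have [S2 [bS2 pS2 cS2]] := @dominated_matrix_op T
  (fun n k => `|s n k| + (complex.Im (s n k))%:C) bT
  (fun n k => pm _ _ (normc_ge_Im _)).
exists 3, (fun i => nth 0 [:: 1; 'i%C; - (1 + 'i%C)] i),
  (fun i => nth S0 [:: S1; S2; S0] i).
split; first by case=> [[|[|[]]]].
apply/funext => x; apply/val_inj/funext => n.
have sT : (\sum_(k < N) s n k * x k : C) @[N --> \oo] --> (T x n : C).
  exact: bounded_op_series.
(* It remains to see the same partial sums converge to the combination of [S1], [S2] and [S0];
   entrywise this is [s = (|s| + Re s) + i (|s| + Im s) - (1 + i) |s|]. *)
apply: (cvg_unique (@norm_hausdorff _ C) sT).
rewrite (_ : (fun N => _) = fun N =>
   1 * (\sum_(k < N) (`|s n k| + (complex.Re (s n k))%:C) * x k)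
   + 'i%C * (\sum_(k < N) (`|s n k| + (complex.Im (s n k))%:C) * x k)
   + - (1 + 'i%C) * \sum_(k < N) `|s n k| * x k); last first.
  apply/funext => N; rewrite !mulr_sumr -!big_split; apply: eq_bigr => k _ /=.
  rewrite -/(s n k) {1}[s n k]complexE; ring.
have scaled (a : C) (f : nat -> C) (l : C) : f N @[N --> \oo] --> l ->
    (a * f N : C) @[N --> \oo] --> (a * l : C).
  by move=> fl; exact: (@cvgM C _ _ _ (fun=> a) f a l (cvg_cst a) fl).
have h1 := scaled 1 _ _ (cS1 x n).
have h2 := scaled 'i%C _ _ (cS2 x n).
have h0 := scaled (- (1 + 'i%C)) _ _ (cS0 x n).
rewrite !big_ord_recr big_ord0 /= add0r.
have cvgS := @cvgD C C _ _ _ _ _ _ _ (@cvgD C C _ _ _ _ _ _ _ h1 h2) h0.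
exact: cvgS.
Qed.

(** Bounded operators contain 0 and are closed under sums and scalar multiples. *)
Lemma regular_op_bounded (T : c0 C -> c0 C) : regular_op T -> bounded_op T.
Proof.
move=> [m [a [S [bS ->]]]]; elim/big_ind: _ => [|T1 T2|i _].
- split=> [b x y|x]; last exact: (@cst_continuous (c0 C) (c0 C) 0 x).
  by apply/esym; rewrite [LHS](_ : _ = b *: 0 + 0 :> c0 C)// scaler0 addr0.
- move=> [linT1 contT1] [linT2 contT2]; split=> [b x y|x].
    by rewrite ![(T1 + T2) _]/(T1 _ + T2 _) linT1 linT2 scalerDr addrACA.
  exact: (@cvgD C (c0 C) _ _ _ _ _ _ _ (contT1 x) (contT2 x)).
- have [[linS contS] _] := bS i; split=> [b x y|x].
    have scaleE z : (a i *: S i) z = a i *: S i z by [].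
    by rewrite !scaleE linS scalerDr !scalerA mulrC.
  exact: (@cvgZ C (c0 C) _ _ _ _ _ _ _ (cvg_cst (a i : C)) (contS x)).
Qed.

End null_sequence_space.

(** * The Cesàro operator and its two spectra *)

Section cesaro.
Context {R : realType}.
Local Notation C := (R[i] : numFieldType).

Lemma cesaro_op_linear : linear (cesaro_op R).
Proof.
move=> a x y; apply/val_inj/funext => n.
rewrite [RHS]c0_addE c0_scaleE /= /cesaro_seq mulrCA -mulrDr; congr (_ * _).
rewrite mulr_sumr -big_split; exact: eq_bigr.
Qed.

(** An average of [n.+1] entries has modulus at most [|x|], so 1 is a bound. *)
Lemma cesaro_op_bounded : bounded_op (cesaro_op R).
Proof.
apply/(bounded_opP cesaro_op_linear); exists 1 => // x; rewrite mul1r.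
apply: c0_norm_le => n; rewrite /= /cesaro_seq normrM normfV normr_nat.
rewrite ler_pdivrMl// (le_trans (ler_norm_sum _ _ _))//.
apply: (@le_trans _ _ (\sum_(k < n.+1) `|x|)).
  by apply: ler_sum => k _; exact: le_c0_norm.
by rewrite sumr_const card_ord mulr_natl.
Qed.

Lemma cesaro_op_positive : positive_op (cesaro_op R).
Proof.
move=> x /c0_leP x0; apply/c0_leP => n; apply: mulr_ge0.
  by rewrite invr_ge0.
by apply: sumr_ge0 => k _; exact: x0.
Qed.

End cesaro.

Theorem proposition4p4 (R : realType) :
  [/\ bounded_op (cesaro_op R), positive_op (cesaro_op R) &
      order_spectrum (cesaro_op R) = spectrum (cesaro_op R)].
Proof.
split; [exact: cesaro_op_bounded|exact: cesaro_op_positive|].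
(* Both spectra arise from one construction, so it suffices that the two sets of operators
   coincide. *)
rewrite /order_spectrum /spectrum; congr (spectrum_in _ _).
apply/seteqP; split=> T; [exact: regular_op_bounded|exact: bounded_op_regular].
Qed.
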